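(* Let $H$ be a fixed graph on $k$ vertices and let $\mathcal{P}_H$ denote the property of containing $H$ as a subgraph. Then, as $n\to\infty$, \[ \mathrm{min\text{-}cost}_n(\mathcal{P}_H) = \Omega(n^{1/k}). \]
   Context: Node-query setting: a graph $G=(V,E)$ on $n$ vertices and a graph property $\mathcal{P}$ are fixed. An unknown subset $S \subseteq V$ is accessible only via queries ''Does $i \in S$?''. $\mathrm{cost}(\mathcal{P},G)$ is the deterministic query complexity (worst-case number of queries of an optimal decision tree) of deciding whether the induced subgraph $G[S]$ satisfies $\mathcal{P}$. A vertex $i$ of $G$ is relevant for $\mathcal{P}$ if there is some $S \ni i$ such that exactly one of $G[S]$ and $G[S\setminus\{i\}]$ satisfies $\mathcal{P}$; $G$ is relevant for $\mathcal{P}$ if all its vertices are relevant. $\mathrm{min\text{-}cost}_n(\mathcal{P}) = \min\{\mathrm{cost}(\mathcal{P},G) : G \text{ relevant for } \mathcal{P},\ |V(G)|=n\}$. *)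

(* Defs.v *)
From mathcomp Require Import all_boot all_order.
From mathcomp Require Import boolp classical_sets.

Set Implicit Arguments.
Unset Strict Implicit.
Unset Printing Implicit Defensive.

Local Open Scope classical_set_scope.
Local Open Scope nat_scope.

(* The minimum of a set of natural numbers; 0 for the empty set. *)
Definition min_set (A : set nat) : nat := xget 0 (A `&` lbound A).

Lemma min_setP (A : set nat) : A !=set0 -> (A `&` lbound A) (min_set A).
Proof.
move=> [m Am]; apply: (@xgetPex _ 0 (A `&` lbound A)).
have exA : exists n, `[< A n >] by exists m; apply/asboolP.
case: (ex_minnP exA) => n /asboolP An n_min; exists n; split=> // j Aj.
exact/n_min/asboolP.
Qed.

(* Finite simple graphs; the graph without vertices is allowed, as G[S] may be
   empty. *)
Record sgraph := SGraph {
  vertex :> finType;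
  edge : rel vertex;
  edge_sym : symmetric edge;
  edge_irrefl : irreflexive edge
}.

Definition isomorphic (G H : sgraph) : Prop :=
  exists2 f : G -> H, bijective f & {mono f : x y / edge x y}.

Record graph_property := GraphProperty {
  satisfies :> sgraph -> bool;
  satisfies_iso : forall G H, isomorphic G H -> satisfies G = satisfies H
}.

Section Induced.
Variables (G : sgraph) (S : {set G}).

Definition induced_edge : rel {x : G | x \in S} := relpre val (@edge G).

Fact induced_edge_sym : symmetric induced_edge.
Proof. by move=> x y; apply: edge_sym. Qed.

Fact induced_edge_irrefl : irreflexive induced_edge.
Proof. by move=> x; apply: edge_irrefl. Qed.

Definition induced : sgraph := SGraph induced_edge_sym induced_edge_irrefl.

End Induced.

(* H is a subgraph, not necessarily induced, of G. *)
Definition has_copy (H G : sgraph) : Prop :=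
  exists2 f : H -> G, injective f & {homo f : x y / edge x y}.

Fact has_copy_iso (H G1 G2 : sgraph) :
  isomorphic G1 G2 -> `[< has_copy H G1 >] = `[< has_copy H G2 >].
Proof.
move=> [f [g fK gK] f_mono]; apply/asbool_equiv_eq; split.
- move=> [h h_inj h_homo]; exists (f \o h).
    exact: inj_comp (can_inj fK) h_inj.
  by move=> x y /h_homo; rewrite /= f_mono.
- move=> [h h_inj h_homo]; exists (g \o h).
    exact: inj_comp (can_inj gK) h_inj.
  by move=> x y /h_homo; rewrite /= -f_mono !gK.
Qed.

Definition contains (H : sgraph) : graph_property :=
  GraphProperty (@has_copy_iso H).

(* [Query i t0 t1] asks whether i belongs to the hidden set and continues with
   t1 if it does, with t0 otherwise. *)
Inductive dtree (V : Type) : Type :=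
| Answer of bool
| Query of V & dtree V & dtree V.

Arguments Answer {V}.

Fixpoint answer (V : finType) (t : dtree V) (S : {set V}) : bool :=
  match t with
  | Answer b => b
  | Query i t0 t1 => answer (if i \in S then t1 else t0) S
  end.

Fixpoint queries (V : finType) (t : dtree V) (S : {set V}) : nat :=
  match t with
  | Answer _ => 0
  | Query i t0 t1 => (queries (if i \in S then t1 else t0) S).+1
  end.

Definition worst_case (V : finType) (t : dtree V) : nat :=
  \max_(S : {set V}) queries t S.

Section Cost.
Variables (P : graph_property) (G : sgraph).

Definition decides (t : dtree G) : Prop :=
  forall S : {set G}, answer t S = P (induced S).

Definition cost : nat := min_set [set worst_case t | t in decides].

Definition relevant_vertex (i : G) : Prop :=
  exists2 S : {set G}, i \in S & P (induced S) (+) P (induced (S :\ i)%SET).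

Definition relevant : Prop := forall i : G, relevant_vertex i.

End Cost.

Definition min_cost (P : graph_property) (n : nat) : nat :=
  min_set [set m | exists G : sgraph,
                     [/\ relevant P G, #|G| = n & cost P G = m]].

Lemma exists_dtree (V : finType) (f : {set V} -> bool) :
  exists t : dtree V, forall S, answer t S = f S.
Proof.
suff [t tP] : exists t : dtree V,
    forall S, answer t S = f [set x in S | x \in enum V]%SET.
  exists t => S; rewrite tP; congr f.
  by apply/setP=> x; rewrite inE mem_enum andbT.
elim: (enum V) f => [|i s IHs] f.
  exists (Answer (f finset.set0)) => S /=; congr f.
  by apply/setP=> x; rewrite !inE andbF.
have [t0 t0P] := IHs (fun A => f (A :\ i)%SET).
have [t1 t1P] := IHs (fun A => f (i |: A)%SET).
exists (Query i t0 t1) => S /=; case: ifP => iS; rewrite ?t0P ?t1P; congr f;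
  apply/setP=> x; rewrite !inE; case: eqVneq => // ->; rewrite ?iS //.
Qed.

Lemma costP (P : graph_property) (G : sgraph) :
  (exists2 t : dtree G, decides P t & worst_case t = cost P G) /\
  (forall t : dtree G, decides P t -> cost P G <= worst_case t).
Proof.
have [t tP] := exists_dtree (fun S : {set G} => P (induced S)).
have [//|tmin lb] := @min_setP [set worst_case t | t in @decides P G].
  by exists (worst_case t), t.
by split=> // u uP; apply: lb; exists u.
Qed.

Definition complete (n : nat) : sgraph :=
  @SGraph 'I_n (fun x y => x != y) (fun x y => congr1 negb (eq_sym x y))
    (fun x => negbF (eqxx x)).

Lemma contains_induced_complete (H : sgraph) n (S : {set complete n}) :
  contains H (induced S) = (#|H| <= #|S|).
Proof.
have cardS : #|induced S| = #|S| by rewrite card_sig; apply: eq_card.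
rewrite -cardS; apply/asboolP/idP => [[f f_inj _]|leHS]; first exact: leq_card f_inj.
pose f x : induced S := enum_val (widen_ord leHS (enum_rank x)).
have f_inj : injective f.
  by move=> x y /enum_val_inj/(congr1 val)/= /ord_inj/enum_rank_inj.
exists f => // x y xy; rewrite /= /induced_edge /=; apply/eqP => /val_inj/f_inj eq_xy.
by move: xy; rewrite eq_xy edge_irrefl.
Qed.

Lemma complete_relevant (H : sgraph) n :
  0 < #|H| <= n -> relevant (contains H) (complete n).
Proof.
move=> /andP[H_gt0 leHn] i.
have /card_geqP[s [s_uniq sz_s s_sub]] : #|H|.-1 <= #|[set~ i]%SET|.
  by rewrite cardsC1 card_ord -!subn1 leq_sub2r.
have is' : i \notin [set x in s]%SET.
  by rewrite inE; apply/negP => /s_sub; rewrite !inE eqxx.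
have card_s : #|[set x in s]%SET| = #|H|.-1.
  by rewrite cardsE (card_uniqP s_uniq).
exists (i |: [set x in s])%SET; first by rewrite !inE eqxx.
rewrite !contains_induced_complete setU1K // cardsU1 is' card_s.
by rewrite add1n prednK // leqnn -ltnS prednK // ltnn.
Qed.

(* The minimum defining min_cost is over a nonempty set for large n. *)
Lemma min_cost_containsP (H : sgraph) n : 0 < #|H| <= n ->
  (exists G : sgraph, [/\ relevant (contains H) G, #|G| = n
    & cost (contains H) G = min_cost (contains H) n]) /\
  (forall G : sgraph, relevant (contains H) G -> #|G| = n ->
    min_cost (contains H) n <= cost (contains H) G).
Proof.
move=> Hn; have [|G_min lb] := @min_setP [set m | exists G : sgraph,
  [/\ relevant (contains H) G, #|G| = n & cost (contains H) G = m]].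
  exists (cost (contains H) (complete n)), (complete n).
  by split; [exact: complete_relevant | exact: card_ord |].
by split=> // G relG cardG; apply: lb; exists G.
Qed.

(* Main.v *)
Require Import Defs.
From mathcomp Require Import all_boot all_order all_algebra.
From mathcomp Require Import all_classical all_reals all_analysis.
Import Order.TTheory GRing.Theory Num.Theory.
Import numFieldNormedType.Exports.
Local Open Scope classical_set_scope.
Local Open Scope ring_scope.

(** Every relevant vertex lies in the vertex set W of a copy of H such that no
    proper subset of W spans a copy. Since the answer changes when any vertex
    of W is removed, a correct decision tree run on W queries all of W, so W is
    the set of positive answers on its branch, and there are at most k of them.
    In a tree of depth d, fewer than (d + 1)^k vertices are queried on branches
    after fewer than k positive answers; hence n < (d + 1)^k. *)

Lemma contains_inducedP (H G : sgraph) (S : {set G}) :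
  reflect (exists f : H -> G, [/\ injective f, {homo f : x y / edge x y}
    & forall x, f x \in S]) (contains H (Defs.induced S)).
Proof.
apply: (iffP (asboolP _)) => [[f f_inj f_homo]|[f [f_inj f_homo fS]]].
- exists (val \o f); split=> [|x y /f_homo //|x].
    exact: inj_comp val_inj f_inj.
  exact: (valP (f x)).
- exists (fun x => exist _ (f x) (fS x) : Defs.induced S).
    by move=> x y /(congr1 val)/f_inj.
  by move=> x y /f_homo.
Qed.

(** Containment is monotone, so it is [S] that spans a copy and [S :\ v] that does not. Any copy
    inside [S] therefore uses [v], and its image has exactly [#|H|] vertices, too few for a copy
    once one is removed. *)
Lemma relevant_vertex_in_minimal_copy (H G : sgraph) (v : G) :
  relevant_vertex (contains H) v ->
  exists2 W : {set G}, v \in W & (#|W| <= #|H|)%N /\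
    forall u, u \in W ->
      contains H (Defs.induced W) != contains H (Defs.induced (W :\ u)%SET).
Proof.
move=> [S vS]; set a := contains _ _; set b := contains _ _ => ab.
have ba : b -> a.
  move=> /contains_inducedP[f [f_inj f_homo fS]]; apply/contains_inducedP.
  by exists f; split=> // x; have := fS x; rewrite inE => /andP[].
have /andP[/contains_inducedP[f [f_inj f_homo fS]] /negP nb] : a && ~~ b.
  by case: a b ab ba => [] [] // _ /(_ isT).
pose W := (f @: H)%SET.
have fW x : f x \in W by apply: imset_f.
have cardW : #|W| = #|H| by rewrite card_imset.
have copyW : contains H (Defs.induced W) by apply/contains_inducedP; exists f.
exists W.
  apply: contra_notT nb => vW; apply/contains_inducedP; exists f; split=> // x.
  by rewrite !inE fS andbT; apply: contraNneq vW => <-.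
split=> [|u uW]; first by rewrite cardW.
rewrite copyW eq_sym eqb_id; apply/contains_inducedP => -[g [g_inj _ gW]].
have : (#|H| <= #|(W :\ u)%SET|)%N.
  rewrite -(card_imset H g_inj); apply: subset_leq_card.
  by apply/fintype.subsetP => _ /imsetP[x _ ->].
by rewrite -cardW (cardsD1 u W) uW ltnn.
Qed.

(* Here [K] collects the vertices already answered positively. Only [k] positive
   answers remain on the branch of a set of [F], so a query splits the count
   for [(d.+1, k.+1)] into those for [(d, k.+1)] and [(d, k)]. *)
Lemma card_sensitive_cover (V : finType) (t : dtree V) (F : {set {set V}})
    (K : {set V}) (d k : nat) :
    {in F, forall S : {set V}, [/\ (queries t S <= d)%N, K \subset S,
      (#|S :\: K| <= k)%N &
      {in S :\: K, forall v, answer t S != answer t (S :\ v)%SET}]} ->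
  (#|finset.cover F :\: K| < d.+1 ^ k)%N.
Proof.
elim: t F K d k => [b|i t0 IH0 t1 IH1] F K d k FP.
  (* A leaf is sensitive to no vertex, so every [S] in [F] lies in [K]. *)
  suff -> : finset.cover F :\: K = finset.set0 by rewrite cards0 expn_gt0.
  apply/setP => v; rewrite !inE; apply/negbTE/negP => /andP[vK /bigcupP[S SF vS]].
  have [_ _ _ /(_ v)] := FP S SF.
  by rewrite inE vK vS /= eqxx => /(_ isT).
case: k FP => [|k] FP.
  suff -> : finset.cover F :\: K = finset.set0 by rewrite cards0.
  apply/setP => v; rewrite !inE; apply/negbTE/negP => /andP[vK /bigcupP[S SF vS]].
  have [_ _] := FP S SF; rewrite leqn0 cards_eq0 => /eqP/setP/(_ v).
  by rewrite !inE vK vS.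
case: d FP => [|d] FP.
  suff -> : F = finset.set0 by rewrite /finset.cover big_set0 finset.set0D cards0 exp1n.
  by apply/setP => S; rewrite inE; apply/negP => /FP[].
pose F0 := [set S in F | i \notin S]%SET.
pose F1 := [set S in F | i \in S]%SET.
have bound0 : (#|finset.cover F0 :\: K| < d.+1 ^ k.+1)%N.
  apply: IH0 => S; rewrite inE => /andP[/FP/= [qS KS kS sS] /negbTE iS].
  split=> //; first by move: qS; rewrite iS.
  by move=> v /sS; rewrite !inE iS andbF.
have le_bound : (d.+1 ^ k.+1 <= d.+2 ^ k.+1)%N by rewrite leq_exp2r.
(* Removing [v] distinct from [i] does not change the reply to the query of [i], so sensitivity
   passes to [t1]. *)
have sens1 S v : S \in F1 -> v \in S :\: (i |: K)%SET ->
    answer t1 S != answer t1 (S :\ v)%SET.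
  rewrite !inE negb_or => /andP[/FP/= [_ _ _ sS] iS] /andP[/andP[vi vK] vS].
  by have := sS v; rewrite !inE vK vS iS (eq_sym i) vi => /(_ isT).
(* A repeated query of a vertex of [K] leads every [S] to [t1] and uses up no new positive
   answer. *)
have [iK|iK] := boolP (i \in K).
  suff /leq_trans : (#|finset.cover F :\: K| < d.+1 ^ k.+1)%N by apply.
  apply: IH1 => S SF; have [/= qS KS kS sS] := FP S SF.
  have iS := fintype.subsetP KS i iK.
  split=> //; first by move: qS; rewrite iS.
  move=> v vSK; apply: sens1; first by rewrite inE SF.
  by rewrite (finset.setUidPr _) // finset.sub1set.
have bound1 : (#|finset.cover F1 :\: (i |: K)%SET| < d.+1 ^ k)%N.
  apply: IH1 => S SF1; have := SF1; rewrite inE => /andP[/FP/= [qS KS kS _] iS].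
  split; first by move: qS; rewrite iS.
  - by rewrite finset.subUset finset.sub1set iS.
  - by move: kS; rewrite (cardsD1 i) finset.setDDl finset.setUC !inE iK iS.
  - by move=> v; apply: sens1.
have sub_cover : finset.cover F :\: K \subset
    (finset.cover F0 :\: K) :|: (i |: (finset.cover F1 :\: (i |: K)%SET))%SET.
  apply/fintype.subsetP => v; rewrite !inE => /andP[vK /bigcupP[S SF vS]].
  rewrite vK; case: eqVneq => //= _; rewrite ?orbT // vK /=.
  by case: (boolP (i \in S)) => iS; apply/orP; [right|left];
    apply/bigcupP; exists S; rewrite // inE SF.
apply: leq_ltn_trans (subset_leq_card sub_cover) _.
apply: leq_ltn_trans (leq_card_setU _ _) _.
(* Both bounds are strict, which leaves room for [i] itself. *)
rewrite cardsU1; apply: (@leq_trans (d.+1 ^ k.+1 + d.+1 ^ k)).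
  rewrite -addSn leq_add // (leq_trans _ bound1) // -[X in (_ <= X)%N]add1n.
  by rewrite leq_add2r leq_b1.
(* The sum equals [d.+2 * d.+1 ^ k]. *)
rewrite [(d.+1 ^ _)%N]expnS addnC -mulSn [(d.+2 ^ _)%N]expnS leq_mul //.
by case: (k) => // j; rewrite leq_exp2r.
Qed.

Lemma card_relevant_lt (H G : sgraph) : relevant (contains H) G ->
  (#|G| < (cost (contains H) G).+1 ^ #|H|)%N.
Proof.
move=> relG; have [[t tP <-] _] := costP (contains H) G.
pose F := [set S : {set G} | (#|S| <= #|H|)%N &&
  [forall v in S, answer t S != answer t (S :\ v)%SET]]%SET.
have coverF : finset.cover F = [set: G]%SET.
  apply/setP => v; rewrite inE; apply/bigcupP.
  have [W vW [cardW sW]] := relevant_vertex_in_minimal_copy _ _ _ (relG v).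
  exists W => //; rewrite inE cardW; apply/forall_inP => u uW.
  by rewrite !tP sW.
rewrite -cardsT -coverF -[finset.cover F]finset.setD0; apply: (@card_sensitive_cover _ t) => S.
rewrite inE finset.setD0 => /andP[cardS /forall_inP sS]; split=> //.
  exact: (leq_bigmax S).
exact: finset.sub0set.
Qed.

Theorem theorem2 (R : realType) (H : sgraph) (k : nat)
    (k_gt0 : (0 < k)%N) (cardH : #|H| = k) :
  (fun n : nat => (min_cost (contains H) n)%:R : R)
    \is 'Omega_\oo (fun n : nat => (n%:R : R) `^ k%:R^-1).
Proof.
(* The factor 1/2 pays for passing from [c.+1] to [c], as [c.+1 <= 2 * c] once [c] is positive. *)
rewrite qualifE; apply/asboolP; exists 2^-1; first by rewrite invr_gt0.
near=> n.
have kn : (k <= n)%N by near: n; exact: nbhs_infty_ge.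
(* For [n >= k] relevant graphs exist, so [min_cost] is attained and is not the default 0 of an
   empty minimum. *)
have [|[G [relG cardG costG]] _] := @min_cost_containsP H n.
  by rewrite cardH k_gt0.
set c := min_cost _ _ in costG *.
have := card_relevant_lt H G relG; rewrite cardG costG cardH => n_lt.
have c_gt0 : (0 < c)%N.
  rewrite lt0n; apply: contraTneq n_lt => ->.
  by rewrite exp1n -leqNgt (leq_trans k_gt0).
rewrite ger0_norm ?powR_ge0 // normr_nat ler_pdivrMl //.
apply: (@le_trans _ _ (c.+1%:R)); last first.
  by rewrite -natrM ler_nat mul2n -addnn -[X in (X <= _)%N]addn1 leq_add2l.
have -> : c.+1%:R = ((c.+1 ^ k)%:R : R) `^ k%:R^-1.
  by rewrite natrX -powR_mulrn // -powRrM divff ?powRr1 // pnatr_eq0 -lt0n.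
by apply: ge0_ler_powR; rewrite ?nnegrE ?invr_ge0 // ler_nat ltnW.
Unshelve. all: by end_near. Qed.
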